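(* Let $A=I-W\in\mathbb{R}^{N\times N}$ be a frozen transport matrix with directed dependency graph $\mathcal{G}(A)$, and assume that the diagonal entries of $A$ are nonzero. Then $\mathcal{G}(A)$ is a directed acyclic graph (contains no directed cycle) if and only if there exists an $N\times N$ permutation matrix $\Pi$ such that $\Pi A\Pi^{T}$ is triangular.
   Context: The frozen transport matrix is $A=I-W$, where $W=(w_{ij})\in\mathbb{R}^{N\times N}$ is entrywise nonnegative with zero diagonal: $w_{ij}>0$ occurs only when $j\neq i$ is a selected upstream neighbor of node $i$, so that row $i$ of $A\,\delta\mathbf{T}=\mathbf{q}$ reads $\delta T_i-\sum_{j\neq i}w_{ij}\,\delta T_j=q_i$. The directed dependency graph $\mathcal{G}(A)=(V,E)$ has vertex set $V=\{1,\dots,N\}$ and an edge $j\to i$ if and only if $w_{ij}>0$. ''Triangular'' means lower triangular or upper triangular. *)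

(* Defs.v *)
From mathcomp Require Import all_boot all_order all_algebra.
From mathcomp Require Import reals.
Set Implicit Arguments.
Unset Strict Implicit.
Unset Printing Implicit Defensive.
Import Order.TTheory GRing.Theory Num.Theory.
Local Open Scope ring_scope.

Definition frozen_weights (R : realType) (N : nat) (W : 'M[R]_N) : Prop :=
  (forall i j, 0 <= W i j) /\ (forall i, W i i = 0).

Definition transport_mx (R : realType) (N : nat) (W : 'M[R]_N) : 'M[R]_N :=
  1%:M - W.

(* Information flows from the upstream node to the row that uses it: column
   index j is the tail of the edge and row index i its head. *)
Definition dependency_graph (R : realType) (N : nat) (W : 'M[R]_N) :
  rel 'I_N := fun j i => 0 < W i j.

(* [ucycle e c] holds for the empty sequence, which is not a directed cycle; a
   singleton [:: x] is a cycle when x has a self-loop. *)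
Definition acyclic (T : eqType) (e : rel T) : Prop :=
  forall c : seq T, c != [::] -> ~ ucycle e c.

(* [is_trig_mx] means lower triangular. *)
Definition is_triangular_mx (R : realType) (N : nat) (A : 'M[R]_N) : bool :=
  is_trig_mx A || is_trig_mx A^T.

(* Main.v *)
Require Import Defs.
From mathcomp Require Import all_boot all_order all_algebra all_fingroup.
From mathcomp Require Import reals.
Import Order.TTheory GRing.Theory Num.Theory.
Set Implicit Arguments.
Unset Strict Implicit.
Unset Printing Implicit Defensive.
Local Open Scope ring_scope.

(** Off the diagonal, [A] and [W] have the same zero pattern, and conjugation
    by the permutation matrix of [s] replaces the entry [(i, j)] of [A] by
    [(s i, s j)].  So a symmetric permutation makes [A] lower triangular
    exactly when [s^-1] numbers the vertices with every edge going from a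
    smaller to a larger number, and upper triangular when all edges go the
    other way.  The proposition is thus the fact that a finite directed graph
    is acyclic iff it has a topological numbering.

    A numbering excludes cycles because going around one would make the
    number of a vertex smaller than itself ([sub_strict_order_acyclic]).  Conversely, in
    an acyclic graph the number of ancestors of a vertex strictly increases
    along each edge, so sorting the vertices by this number yields a
    topological numbering ([acyclic_topological_sort]). *)

Lemma sub_strict_order_acyclic (T : eqType) (e r : rel T) :
  irreflexive r -> transitive r -> subrel e r -> acyclic e.
Proof.
move=> r_irr r_tr sub_er [|x p] // _ /andP[cyc _].
have /(order_path_min r_tr) /allP r_x : path r x (rcons p x).
  exact: sub_path sub_er _ _ cyc.
by have := r_x x; rewrite mem_rcons mem_head r_irr => /(_ isT).
Qed.

(** A path leading back from [y] to [x] may revisit vertices, but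
    it can be shortened to a simple one, which the edge from [x] to [y] then
    closes into a simple cycle. *)
Lemma acyclic_edge_not_connect (T : finType) (e : rel T) (x y : T) :
  acyclic e -> e x y -> ~~ connect e y x.
Proof.
move=> acyc e_xy; apply/negP => /connectP[p e_p x_last].
move: e_xy; rewrite x_last; case/shortenP: e_p => p' e_p' uniq_p' _ e_back.
apply: (acyc (y :: p')) => //.
by rewrite /ucycle /= rcons_path e_p' e_back.
Qed.

Lemma card_ancestors_lt (T : finType) (e : rel T) (x y : T) :
  acyclic e -> e x y ->
  (#|[pred z | connect e z x]| < #|[pred z | connect e z y]|)%N.
Proof.
move=> acyc e_xy; apply/proper_card/properP; split.
  apply/subsetP => z; rewrite !inE => e_zx.
  exact: connect_trans e_zx (connect1 e_xy).
exists y; rewrite !inE ?connect0 //.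
exact: acyclic_edge_not_connect acyc e_xy.
Qed.

(** Any potential on ['I_N] can be refined to a bijective
    numbering: sort the vertices by potential and number them by position. *)
Lemma perm_refines_potential (N : nat) (d : 'I_N -> nat) :
  exists s : {perm 'I_N}, forall x y, (d x < d y)%N -> (s x < s y)%N.
Proof.
pose le_d : rel 'I_N := fun x y => (d x <= d y)%N.
have le_d_total : total le_d by move=> x y; exact: leq_total.
have le_d_tr : transitive le_d by move=> y x z; exact: leq_trans.
pose l := sort le_d (enum 'I_N).
have l_all x : x \in l by rewrite mem_sort mem_enum.
have idx_lt x : (index x l < N)%N.
  by rewrite -[X in (_ < X)%N]size_enum_ord -(size_sort le_d) index_mem.
pose rank x := Ordinal (idx_lt x).
have rank_inj : injective rank.
  by move=> x y /(congr1 val) /= eq_idx; apply: index_inj eq_idx.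
exists (perm rank_inj) => x y; rewrite !permE /=; apply: contraTT.
rewrite -!leqNgt => le_idx.
have l_sorted : sorted le_d l by apply: sort_sorted.
by apply: (sorted_leq_index le_d_tr _ l_sorted) => // z; rewrite /le_d.
Qed.

Lemma acyclic_topological_sort (N : nat) (e : rel 'I_N) :
  acyclic e -> exists s : {perm 'I_N}, forall x y, e x y -> (s x < s y)%N.
Proof.
move=> acyc.
have [s s_mono] :=
  perm_refines_potential (fun x => #|[pred z | connect e z x]|).
by exists s => x y e_xy; apply/s_mono/card_ancestors_lt.
Qed.

Lemma perm_mx_conjE (R : pzSemiRingType) (N : nat) (s : {perm 'I_N})
    (A : 'M[R]_N) (i j : 'I_N) :
  (perm_mx s *m A *m (perm_mx s)^T) i j = A (s i) (s j).
Proof. by rewrite tr_perm_mx -row_permE -col_permE !mxE. Qed.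

Lemma transport_mx_offdiag (R : realType) (N : nat) (W : 'M[R]_N) (i j : 'I_N) :
  i != j -> transport_mx W i j = - W i j.
Proof. by move=> /negPf ij; rewrite /transport_mx !mxE ij sub0r. Qed.

(** The vanishing diagonal of [W] excludes self-loops, so an edge always lands
    on an off-diagonal entry of [A], where the zero patterns agree. *)
Lemma edge_transport_mx_neq0 (R : realType) (N : nat) (W : 'M[R]_N)
    (i j : 'I_N) :
  frozen_weights W -> dependency_graph W j i ->
  i != j /\ transport_mx W i j != 0.
Proof.
case=> _ W0; rewrite /dependency_graph => W_gt0.
have ij : i != j by apply: contraTneq W_gt0 => ->; rewrite W0 ltxx.
by split; rewrite // transport_mx_offdiag // oppr_eq0 lt0r_neq0.
Qed.

Theorem proposition3p1 (R : realType) (N : nat) (A W : 'M[R]_N)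
    (hW : frozen_weights W)
    (hA : A = transport_mx W)
    (hdiag : forall i, A i i != 0) :
  acyclic (dependency_graph W) <->
  exists P : 'M[R]_N, is_perm_mx P /\ is_triangular_mx (P *m A *m P^T).
Proof.
subst A; split=> [/acyclic_topological_sort[s s_mono] | ].
  (* Row [i] of the conjugated matrix is row [s^-1 i] of [A]: the inverse puts
     vertex [x] at position [s x]. *)
  exists (perm_mx s^-1); split; first exact: perm_mx_is_perm.
  apply/orP; left; apply/is_trig_mxP => i j lt_ij.
  rewrite perm_mx_conjE transport_mx_offdiag; last first.
    by rewrite (inj_eq perm_inj); apply: contraTneq lt_ij => ->; rewrite ltnn.
  apply/eqP; rewrite oppr_eq0; apply: contraLR lt_ij => W_neq0.
  rewrite -leqNgt ltnW //.
  have /s_mono : dependency_graph W (s^-1 j)%g (s^-1 i)%g.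
    by rewrite /dependency_graph lt0r W_neq0 hW.1.
  by rewrite !permKV.
case=> P [/is_perm_mxP[s ->]] /orP[] /is_trig_mxP A_trig.
- apply: (@sub_strict_order_acyclic _ _
    (fun x y => (s^-1 x < s^-1 y)%g%N)) => [x | y x z | j i e_ji].
  + exact: ltnn.
  + exact: ltn_trans.
  have [ij A_neq0] := edge_transport_mx_neq0 hW e_ji.
  rewrite ltnNge leq_eqVlt negb_or (inj_eq val_inj) (inj_eq perm_inj) ij /=.
  apply: contra_neqN A_neq0 => /A_trig.
  by rewrite perm_mx_conjE !permKV.
- apply: (@sub_strict_order_acyclic _ _
    (fun x y => (s^-1 y < s^-1 x)%g%N)) => [x | y x z xy yz | j i e_ji].
  + exact: ltnn.
  + exact: ltn_trans yz xy.
  have [ij A_neq0] := edge_transport_mx_neq0 hW e_ji.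
  rewrite ltnNge leq_eqVlt negb_or (inj_eq val_inj) (inj_eq perm_inj).
  rewrite eq_sym ij /=; apply: contra_neqN A_neq0 => /A_trig.
  by rewrite mxE perm_mx_conjE !permKV.
Qed.
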